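(* Let $\mathbb{F}$ be $\mathbb{R}$ or $\mathbb{C}$, let $n>d$, and let $\{\varphi_j\}_{j=1}^{n}$ be an equiangular tight frame (ETF) for a $d$-dimensional Hilbert space over $\mathbb{F}$, scaled so that $\|\varphi_j\|^2=s$ for all $j$, where $s=\left[\frac{d(n-1)}{n-d}\right]^{1/2}$. For each $i=1,\dots,b$, let $\mathcal{K}_i\subseteq\{1,\dots,n\}$ be such that $\{\varphi_j\}_{j\in\mathcal{K}_i}$ is a regular simplex, and take scalars $\{c_{i,j}\}_{j\in\mathcal{K}_i}$ in $\mathbb{F}$ such that $$\sum_{j\in\mathcal{K}_i}\overline{c_{i,j}}\,\varphi_j=0\quad\text{and}\quad|c_{i,j}|=1\ \text{ for all }j\in\mathcal{K}_i.$$ Then these scalars satisfy $$\overline{c_{i,j}}\,c_{i,j'}=\overline{c_{i',j}}\,c_{i',j'}\quad\text{for all } i\neq i',\ j\neq j'\text{ such that } j,j'\in\mathcal{K}_i\cap\mathcal{K}_{i'}.$$ Moreover, if $\{\mathcal{K}_i\}_{i=1}^b$ is a $\mathrm{BIBD}(n,s+1,\lambda)$ for some $\lambda>0$, then the columns $\{\psi_j\}_{j=1}^n$ of the matrix $\Psi\in\mathbb{F}^{b\times n}$ defined by $$\Psi(i,j)=\begin{cases}\frac{1}{\sqrt{\lambda}}\,c_{i,j},& j\in\mathcal{K}_i,\\ 0,& j\notin\mathcal{K}_i,\end{cases}$$ form a Naimark complement of $\{\varphi_j\}_{j=1}^n$.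
   Context: Inner products are conjugate-linear in the first argument. A finite sequence $\{\varphi_j\}_{j=1}^n$ of nonzero vectors in a Hilbert space $\mathbb{H}$ is an ETF for $\mathbb{H}$ if $\|\varphi_j\|$ is constant over $j$, $|\langle\varphi_j,\varphi_{j'}\rangle|$ is constant over all $j\neq j'$, and it is an $a$-tight frame for $\mathbb{H}$ for some $a>0$, meaning $\sum_{j=1}^n\langle\varphi_j,y\rangle\varphi_j=ay$ for all $y\in\mathbb{H}$. For a positive integer $s$, a regular $s$-simplex is a sequence of $s+1$ vectors that is an ETF for its span, where this span has dimension $s$; a regular simplex is a regular $s$-simplex for some $s$. If $\{\varphi_j\}_{j=1}^n$ is an $a$-tight frame for its span and this span has dimension less than $n$, a Naimark complement of it is a sequence $\{\psi_j\}_{j=1}^n$ of vectors in a Hilbert space over $\mathbb{F}$ with $\Psi^*\Psi=a\mathbf{I}-\Phi^*\Phi$, where $(\Phi^*\Phi)(j,j')=\langle\varphi_j,\varphi_{j'}\rangle$ and $(\Psi^*\Psi)(j,j')=\langle\psi_j,\psi_{j'}\rangle$ are the Gram matrices. For positive integers $v>k\geq2$ and $\lambda$, a $\mathrm{BIBD}(v,k,\lambda)$ (balanced incomplete block design) is a $v$-element vertex set (here $\{1,\dots,n\}$ with $v=n$) together with a finite family of subsets called blocks such that every block contains exactly $k$ vertices and every pair of distinct vertices is contained in exactly $\lambda$ blocks. *)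

(* Defs.v *)
From HB Require Import structures.
From mathcomp Require Import all_boot all_order all_algebra.
From mathcomp Require Import reals complex.

Set Implicit Arguments.
Unset Strict Implicit.
Unset Printing Implicit Defensive.

Import Order.TTheory GRing.Theory Num.Theory.
Local Open Scope ring_scope.

(* The field F of scalars, which is either R or C = R[i], as a function of a
   two-valued parameter, so that one statement covers both cases. *)
Inductive scalar_kind := RealScalars | ComplexScalars.

Definition scalars (R : realType) (k : scalar_kind) : numFieldType :=
  match k with
  | RealScalars => R : numFieldType
  | ComplexScalars => R[i] : numFieldType
  end.

Definition conjS (R : realType) (k : scalar_kind) : scalars R k -> scalars R k :=
  match k with
  | RealScalars => fun x : R => x
  | ComplexScalars => fun x : R[i] => conjc x
  end.

Definition ofR (R : realType) (k : scalar_kind) : R -> scalars R k :=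
  match k with
  | RealScalars => fun x : R => x
  | ComplexScalars => fun x : R => x%:C%C
  end.

Definition ReS (R : realType) (k : scalar_kind) : scalars R k -> R :=
  match k with
  | RealScalars => fun x : R => x
  | ComplexScalars => fun x : R[i] => complex.Re x
  end.

Arguments conjS {R k} _.
Arguments ofR {R k} _.
Arguments ReS {R k} _.

Lemma conjSB (R : realType) (k : scalar_kind) (x y : scalars R k) :
  conjS (x - y) = conjS x - conjS y.
Proof. by case: k x y => //= x y; rewrite rmorphB. Qed.

Lemma conjSM (R : realType) (k : scalar_kind) (x y : scalars R k) :
  conjS (x * y) = conjS x * conjS y.
Proof. by case: k x y => //= x y; rewrite rmorphM. Qed.

Lemma conjSK (R : realType) (k : scalar_kind) (x : scalars R k) :
  conjS (conjS x) = x.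
Proof. by case: k x => //= x; rewrite conjcK. Qed.

Lemma mulS_conj (R : realType) (k : scalar_kind) (x : scalars R k) :
  x * conjS x = `|x| ^+ 2.
Proof.
case: k x => /= x; first by rewrite real_normK ?num_real ?expr2.
by rewrite sqr_normc.
Qed.

(* A finite-dimensional Hilbert space over F is a [H : vectType F] together with
   [dot : {dot H for conjS}].  Library forms are linear in their first argument
   and conjugate-linear in the second; [inner] swaps the arguments, so that it is
   conjugate-linear in the first one. *)
Section Frames.
Variables (R : realType) (k : scalar_kind).
Local Notation F := (scalars R k).
Variables (H : vectType F) (dot : {dot H for (@conjS R k)}).

Definition inner (x y : H) : F := dot y x.

Definition hnorm (x : H) : R := Num.sqrt (ReS (inner x x)).

Definition seq_span (I : finType) (phi : I -> H) : {vspace H} :=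
  <<[seq phi j | j : I]>>%VS.

(* [phi] is an [a]-tight frame for the subspace [U] (with [U := fullv] for the
   whole space). *)
Definition tight_frame (I : finType) (U : {vspace H}) (a : R) (phi : I -> H) :=
  [/\ 0 < a, forall j, phi j \in U &
      forall y, y \in U -> \sum_j inner (phi j) y *: phi j = ofR a *: y].

Definition ETF (I : finType) (U : {vspace H}) (phi : I -> H) :=
  [/\ forall j, phi j != 0,
      exists r : R, forall j, hnorm (phi j) = r,
      exists mu : F, forall j j', j != j' -> `|inner (phi j) (phi j')| = mu &
      exists a : R, tight_frame U a phi].

Definition regular_s_simplex (s : nat) (I : finType) (phi : I -> H) :=
  [/\ (0 < s)%N, #|I| = s.+1, ETF (seq_span phi) phi & \dim (seq_span phi) = s].

Definition regular_simplex (I : finType) (phi : I -> H) :=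
  exists s : nat, regular_s_simplex s phi.

Definition gram (n : nat) (phi : 'I_n -> H) : 'M[F]_n :=
  \matrix_(j, j') inner (phi j) (phi j').

End Frames.

Definition naimark_complement (R : realType) (k : scalar_kind)
    (H : vectType (scalars R k)) (dotH : {dot H for (@conjS R k)})
    (K : vectType (scalars R k)) (dotK : {dot K for (@conjS R k)})
    (n : nat) (phi : 'I_n -> H) (psi : 'I_n -> K) :=
  exists a : R,
    [/\ tight_frame dotH (seq_span phi) a phi,
        (\dim (seq_span phi) < n)%N &
        gram dotK psi = (ofR a)%:M - gram dotH phi].

(* F^b as a Hilbert space; [inner (@std_dot R k b) x y] is the sum of
   conj (x_i) * y_i. *)
Section Standard.
Variables (R : realType) (k : scalar_kind) (b : nat).
Local Notation F := (scalars R k).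

Definition std_dot (x y : 'cV[F]_b) : F := \sum_i x i 0 * conjS (y i 0).

Fact std_dot_zmodl (y : 'cV[F]_b) : zmod_morphism (std_dot^~ y).
Proof.
move=> u v; rewrite /std_dot -sumrB; apply: eq_bigr => i _.
by rewrite !mxE mulrBl.
Qed.

Fact std_dot_zmodr (x : 'cV[F]_b) : zmod_morphism (std_dot x).
Proof.
move=> u v; rewrite /std_dot -sumrB; apply: eq_bigr => i _.
by rewrite !mxE conjSB mulrBr.
Qed.

Fact std_dot_scalel (y : 'cV[F]_b) : scalable_for *%R (std_dot^~ y).
Proof.
move=> a u; rewrite /std_dot mulr_sumr; apply: eq_bigr => i _.
by rewrite !mxE mulrA.
Qed.

Fact std_dot_scaler (x : 'cV[F]_b) :
  scalable_for (@conjS R k \; *%R) (std_dot x).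
Proof.
move=> a u; rewrite /std_dot /= mulr_sumr; apply: eq_bigr => i _.
by rewrite !mxE conjSM mulrCA.
Qed.

Fact std_dot_herm (x y : 'cV[F]_b) :
  std_dot x y = (-1) ^+ false * conjS (std_dot y x).
Proof.
rewrite expr0 mul1r /std_dot.
have conjS_sum (f : 'I_b -> F) : conjS (\sum_i f i) = \sum_i conjS (f i).
  have c0 : conjS (0 : F) = 0 by rewrite -[X in conjS X](subrr 0) conjSB subrr.
  have cD (u v : F) : conjS (u + v) = conjS u + conjS v.
    by rewrite -[v in LHS]opprK conjSB -[- v]sub0r conjSB c0 sub0r opprK.
  exact: (big_morph _ cD c0).
by rewrite conjS_sum; apply: eq_bigr => i _; rewrite conjSM conjSK mulrC.
Qed.

Fact std_dot_gt0 (u : 'cV[F]_b) : u != 0 -> 0 < std_dot u u.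
Proof.
move=> u_neq0; have [i ui_neq0] : exists i, u i 0 != 0.
  apply/existsP; apply: contraNT u_neq0 => /existsPn u0.
  by apply/eqP/colP => i; rewrite !mxE; apply/eqP; rewrite -[_ == _]negbK.
rewrite /std_dot (bigD1 i) //=; apply: ltr_pwDl.
  by rewrite mulS_conj exprn_gt0 // normr_gt0.
by apply: sumr_ge0 => j _; rewrite mulS_conj exprn_ge0.
Qed.

HB.instance Definition _ :=
  isBilinear.Build F 'cV[F]_b 'cV[F]_b F *%R (@conjS R k \; *%R) std_dot
    std_dot_zmodl std_dot_zmodr std_dot_scalel std_dot_scaler.
HB.instance Definition _ :=
  isHermitianSesquilinear.Build F 'cV[F]_b false (@conjS R k) std_dot
    std_dot_herm.
HB.instance Definition _ :=
  isDotProduct.Build F 'cV[F]_b std_dot std_dot_gt0.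

End Standard.

(* The vertex set is 'I_n and the blocks are a family indexed by 'I_b, so that
   repeated blocks are allowed. *)
Definition is_BIBD (n b : nat) (K : 'I_b -> {set 'I_n}) (m lambda : nat) :=
  [/\ (1 < m < n)%N, (0 < lambda)%N,
      forall i, #|K i| = m &
      forall j j', j != j' -> #|[set i | (j \in K i) && (j' \in K i)]| = lambda].

Definition Psi (R : realType) (k : scalar_kind) (n b : nat)
    (K : 'I_b -> {set 'I_n}) (c : 'I_b -> 'I_n -> scalars R k) (lambda : nat) :
    'M[scalars R k]_(b, n) :=
  \matrix_(i, j)
    if j \in K i then ofR (1 / Num.sqrt lambda%:R) * c i j else 0.

(* Main.v *)
Require Import Defs.
From HB Require Import structures.
From mathcomp Require Import all_boot all_order all_algebra.
From mathcomp Require Import reals complex.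
From mathcomp Require Import ring.

Set Implicit Arguments.
Unset Strict Implicit.
Unset Printing Implicit Defensive.

Import Order.TTheory GRing.Theory Num.Theory.
Local Open Scope ring_scope.

(** With [s] as in the statement the Welch bound is attained at modulus one.
Write [a] for the frame constant of the ETF.  Expanding the frame operator in a
basis gives [a * d = n * s], and evaluating the tight frame identity at one of
the vectors gives [a * s = s ^+ 2 + (n - 1) * mu ^+ 2], where [mu] is the common
modulus of the off-diagonal inner products; eliminating [a] yields [mu = 1]
([welch_coherence]).  The same two identities for a regular simplex of [t + 1]
of these vectors, which spans a space of dimension [t], force [t = s]
([regular_simplex_card]).

Pair the relation [\sum_j conjS (c j) *: phi j = 0] on such a simplex with one
of its vectors [phi j].  The term of index [j] is [s * conjS (c j)]; the other
[s] terms have modulus one and add up to [- s * conjS (c j)].  This is the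
equality case of the triangle inequality, so each of them equals
[- conjS (c j)], that is,
[inner (phi j) (phi j') = - (conjS (c j) * c j')]
([regular_simplex_gram]).  The product [conjS (c j) * c j'] is thus determined
by the ETF alone, whichever block it is read in: this is the first assertion.

For the second one, an off-diagonal entry of the Gram matrix of the columns of
[Psi] is [1 / lambda] times a sum of [lambda] copies of
[- inner (phi j) (phi j')].  A diagonal entry is [r / lambda], where [r] is the
number of blocks through a vertex; the double count [r * s = lambda * (n - 1)]
([BIBD_replication]) turns it into [(n - 1) / s], which is [a - s] by the
identity for [a * s] above. *)

(** * The two scalar fields *)

Section Scalars.
Variables (R : realType) (k : scalar_kind).
Local Notation F := (scalars R k).

Lemma ofR_is_zmod_morphism : zmod_morphism (@ofR R k).
Proof. by case: k => //= x y; rewrite rmorphB. Qed.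

Lemma ofR_is_monoid_morphism : monoid_morphism (@ofR R k).
Proof. by case: k; split=> //= x y; rewrite rmorphM. Qed.

HB.instance Definition _ :=
  GRing.isZmodMorphism.Build R F (@ofR R k) ofR_is_zmod_morphism.
HB.instance Definition _ :=
  GRing.isMonoidMorphism.Build R F (@ofR R k) ofR_is_monoid_morphism.

Lemma conjS_ofR (x : R) : conjS (ofR x : F) = ofR x.
Proof. by case: k => //=; rewrite oppr0. Qed.

Lemma ofR_ReS (x : F) : 0 <= x -> ofR (ReS x) = x.
Proof. by case: k x => //= -[a b]; rewrite lecE /= => /andP[/eqP->]. Qed.

Lemma ReS_ge0 (x : F) : 0 <= x -> 0 <= ReS x.
Proof. by case: k x => //= -[a b]; rewrite lecE /= => /andP[]. Qed.

HB.instance Definition _ :=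
  GRing.isZmodMorphism.Build F F (@conjS R k) (@conjSB R k).

Lemma conjS_nat (m : nat) : conjS (m%:R : F) = m%:R.
Proof. by rewrite -[m%:R](rmorph_nat (@ofR R k)) conjS_ofR. Qed.

Lemma conjS_mul_unit (x : F) : `|x| = 1 -> conjS x * x = 1.
Proof. by move=> x1; rewrite mulrC mulS_conj x1 expr1n. Qed.

Lemma norm_conjS (x : F) : `|conjS x| = `|x|.
Proof.
by apply/eqP; rewrite -(@eqrXn2 _ 2%N) // -!mulS_conj conjSK mulrC.
Qed.

(** Equality case of the triangle inequality for numbers of modulus one.  It is
obtained by expanding [\sum_i `|z i - w| ^+ 2], which the hypotheses make zero;
unlike arguments that use square roots or polar forms, this treats the real and
the complex fields together. *)
Lemma sum_unit_eq_card (I : finType) (A : {pred I}) (z : I -> F) (w : F) :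
  (forall i, i \in A -> `|z i| = 1) -> `|w| = 1 ->
  \sum_(i in A) z i = #|A|%:R * w -> forall i, i \in A -> z i = w.
Proof.
move=> z1 w1 sum_z.
suff /psumr_eq0P: \sum_(i in A) `|z i - w| ^+ 2 = 0.
  move=> dist0 i iA; apply/eqP; rewrite -subr_eq0 -normr_eq0 -sqrf_eq0.
  by rewrite dist0 // => j _; rewrite exprn_ge0.
have sum_conj_z : \sum_(i in A) conjS (z i) = #|A|%:R * conjS w.
  by rewrite -raddf_sum sum_z /= conjSM conjS_nat.
rewrite (eq_bigr (fun i => 2%:R - conjS w * z i - w * conjS (z i))); last first.
  move=> i iA; rewrite -mulS_conj conjSB.
  have := conjS_mul_unit (z1 i iA); have := conjS_mul_unit w1.
  set u := conjS w; set v := conjS (z i) => uw vz.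
  transitivity (v * z i + u * w - u * z i - w * v); first by ring.
  by rewrite uw vz.
rewrite !sumrB sumr_const -!mulr_sumr sum_z sum_conj_z.
have := conjS_mul_unit w1; set u := conjS w => uw.
transitivity (#|A|%:R * 2%:R * (1 - u * w)); first by ring.
by rewrite uw subrr mulr0.
Qed.

End Scalars.

(** * Equiangular tight frames and regular simplices *)

Section TightFrames.
Variables (R : realType) (k : scalar_kind).
Local Notation F := (scalars R k).
Variables (H : vectType F) (dot : {dot H for (@conjS R k)}).
Local Notation inner := (inner dot).

Lemma inner_conj (x y : H) : inner y x = conjS (inner x y).
Proof. by rewrite /Defs.inner hermitian_subproof expr0 mul1r. Qed.

Lemma inner_sumr (I : finType) (P : pred I) (x : H) (a : I -> F) (y : I -> H) :
  inner x (\sum_(i | P i) a i *: y i) = \sum_(i | P i) a i * inner x (y i).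
Proof.
rewrite /Defs.inner linear_sumlz; apply: eq_bigr => i _; exact: linearZl_LR.
Qed.

Lemma inner_self_ge0 (x : H) : 0 <= inner x x.
Proof.
have [->|x0] := eqVneq x 0; first by rewrite /Defs.inner linear0l.
by rewrite ltW // neq0_dnorm_gt0.
Qed.

Lemma inner_self (x : H) : inner x x = ofR (hnorm dot x ^+ 2).
Proof.
by rewrite sqr_sqrtr ?ReS_ge0 ?inner_self_ge0 // ofR_ReS // inner_self_ge0.
Qed.

Variables (I : finType) (phi : I -> H).

(** Both sides are the trace of the frame operator, which is the scalar [a] on
[U].  Its diagonal coefficients in a basis of [U] are computed directly, and
exchanging the two sums reassembles the squared norms. *)
Lemma tight_frame_trace (U : {vspace H}) (a : R) :
  tight_frame dot U a phi ->
  \sum_j inner (phi j) (phi j) = ofR a * (\dim U)%:R.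
Proof.
move=> [_ phiU tightU]; set B := vbasis U.
have freeB : free B := basis_free (vbasisP U).
transitivity (\sum_j \sum_(l < \dim U) coord B l (phi j) * inner (phi j) B`_l).
  apply: eq_bigr => j _; rewrite -inner_sumr; congr (inner _ _).
  exact: coord_vbasis.
rewrite exchange_big /= mulr_natr -[X in _ *+ X]card_ord -sumr_const.
apply: eq_bigr => l _.
have BlU : B`_l \in U by rewrite vbasis_mem ?mem_nth ?size_tuple.
transitivity (coord B l (\sum_j inner (phi j) B`_l *: phi j)).
  rewrite linear_sum; apply: eq_bigr => j _.
  by rewrite linearZ /= mulrC.
by rewrite tightU // linearZ /= coord_free // eqxx mulr1.
Qed.

(** This is the frame identity at [x] paired with [x] itself. *)
Lemma tight_frame_sqnorm (U : {vspace H}) (a : R) (x : H) :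
  tight_frame dot U a phi -> x \in U ->
  \sum_j `|inner (phi j) x| ^+ 2 = ofR a * inner x x.
Proof.
move=> [_ _ tightU] xU.
have := inner_sumr predT x (fun j => inner (phi j) x) phi.
rewrite tightU // /Defs.inner linearZl_LR => ->.
by apply: eq_bigr => j _; rewrite -mulS_conj -inner_conj.
Qed.

(** The trace of the frame operator, and the frame identity at one of the vectors.
The subspace [U] is kept general because both the ETF (with [U] the whole space)
and its regular simplices (with [U] their spans) are instances. *)
Lemma equiangular_tight_relations (U : {vspace H}) (a : R) (N : nat)
    (sigma mu : F) :
  tight_frame dot U a phi -> #|I| = N.+1 ->
  (forall j, inner (phi j) (phi j) = sigma) ->
  (forall j j', j != j' -> `|inner (phi j) (phi j')| = mu) ->
  ofR a * (\dim U)%:R = N.+1%:R * sigma /\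
  ofR a * sigma = sigma ^+ 2 + N%:R * mu ^+ 2.
Proof.
move=> tightU cardI norms angles; split.
  rewrite -tight_frame_trace // (eq_bigr (fun=> sigma)) //.
  by rewrite sumr_const cardI mulr_natl.
have /card_gt0P[j _] : (0 < #|I|)%N by rewrite cardI.
have phijU : phi j \in U by case: tightU.
rewrite -[in LHS](norms j) -(tight_frame_sqnorm tightU phijU) (bigD1 j) //=.
congr (_ + _).
  by rewrite norms ger0_norm // -(norms j) inner_self_ge0.
rewrite (eq_bigr (fun=> mu ^+ 2)) => [|j' j'j]; last by rewrite angles.
have <- : #|predC1 j| = N by rewrite cardC1 cardI.
by rewrite mulr_natl -sumr_const.
Qed.

(** The dimension of a simplex of squared norm [sigma] and coherence one is
[sigma]: if the span has dimension [t], eliminating the frame constant from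
[equiangular_tight_relations] leaves [sigma ^+ 2 = t ^+ 2]. *)
Lemma regular_simplex_card (sigma : F) :
  regular_simplex dot phi -> (forall j, inner (phi j) (phi j) = sigma) ->
  (forall j j', j != j' -> `|inner (phi j) (phi j')| = 1) ->
  #|I|%:R = sigma + 1.
Proof.
move=> [t [t_gt0 cardI [_ _ _ [a tightU]] dimU]] norms angles.
have [] := equiangular_tight_relations tightU cardI norms angles.
rewrite dimU cardI expr1n mulr1 => trace_eq norm_eq.
have sigma_ge0 : 0 <= sigma.
  have /card_gt0P[j _] : (0 < #|I|)%N by rewrite cardI.
  by rewrite -(norms j) inner_self_ge0.
suff -> : sigma = t%:R by rewrite natr1.
apply/eqP; rewrite -(@eqrXn2 _ 2%N) // ?ler0n // -subr_eq0; apply/eqP.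
have : (ofR a * sigma) * t%:R = (t.+1%:R * sigma) * sigma.
  by rewrite -trace_eq; ring.
rewrite norm_eq -natr1 => e.
transitivity ((t%:R + 1) * sigma * sigma - (sigma ^+ 2 + t%:R) * t%:R).
  by ring.
by rewrite e subrr.
Qed.

(** Pairing the linear relation with [phi j] balances [sigma * conjS (c j)] against
[sigma] other terms of modulus one, so [sum_unit_eq_card] forces each of these to
be [- conjS (c j)]. *)
Lemma regular_simplex_gram (sigma : F) (c : I -> F) :
  regular_simplex dot phi -> (forall j, inner (phi j) (phi j) = sigma) ->
  (forall j j', j != j' -> `|inner (phi j) (phi j')| = 1) ->
  \sum_j conjS (c j) *: phi j = 0 -> (forall j, `|c j| = 1) ->
  forall j j', j != j' -> inner (phi j) (phi j') = - (conjS (c j) * c j').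
Proof.
move=> simplex norms angles relation c1 j j' jj'.
have cardI := regular_simplex_card simplex norms angles.
pose z l := conjS (c l) * inner (phi j) (phi l).
suff zj' : z j' = - conjS (c j).
  rewrite -[LHS]mul1r -(conjS_mul_unit (c1 j')) mulrAC -/(z j') zj'.
  by rewrite mulNr.
apply: (@sum_unit_eq_card _ _ _ (predC1 j)).
- move=> l; rewrite inE eq_sym => lj.
  by rewrite normrM norm_conjS c1 angles ?mulr1.
- by rewrite normrN norm_conjS.
- have : \sum_l z l = 0.
    by rewrite -inner_sumr relation /Defs.inner linear0l.
  have -> : #|predC1 j|%:R = sigma.
    apply: (addIr 1); rewrite -cardI natr1 cardC1 prednK //.
    by apply/card_gt0P; exists j.
  rewrite (bigD1 j) //= {1}/z norms => /eqP; rewrite addr_eq0 => /eqP e.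
  by rewrite mulrN mulrC e opprK.
- by rewrite inE eq_sym.
Qed.

(** With [d = \dim U] and [n = N + 1], the hypothesis on [sigma] reads
[sigma ^+ 2 = d * (n - 1) / (n - d)].  This is the scaling at which the Welch bound
[sigma * sqrt ((n - d) / (d * (n - 1)))] on the coherence equals one; tight
equiangular families attain that bound. *)
Lemma welch_coherence (U : {vspace H}) (a : R) (N : nat) (sigma mu : F) :
  tight_frame dot U a phi -> #|I| = N.+1 ->
  (forall j, inner (phi j) (phi j) = sigma) -> sigma != 0 ->
  (forall j j', j != j' -> `|inner (phi j) (phi j')| = mu) ->
  sigma ^+ 2 * (N.+1%:R - (\dim U)%:R) = (\dim U)%:R * N%:R ->
  forall j j', j != j' -> `|inner (phi j) (phi j')| = 1.
Proof.
move=> tightU cardI norms sigma_neq0 angles sigma_def j j' jj'.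
have [] := equiangular_tight_relations tightU cardI norms angles.
set D := (\dim U)%:R in sigma_def *; move=> trace_eq norm_eq.
have D_neq0 : D != 0.
  apply/eqP => D0; move/eqP: trace_eq; rewrite D0 mulr0 eq_sym.
  by rewrite mulf_eq0 pnatr_eq0 (negPf sigma_neq0).
have N_neq0 : N%:R != 0 :> F.
  have : (0 < #|predC1 j|)%N by apply/card_gt0P; exists j'; rewrite inE eq_sym.
  by rewrite cardC1 cardI pnatr_eq0 lt0n.
have mu_ge0 : 0 <= mu by rewrite -(angles j j').
rewrite angles //; apply/eqP; rewrite -(@eqrXn2 _ 2%N) // expr1n; apply/eqP.
apply: (mulfI (mulf_neq0 D_neq0 N_neq0)); rewrite mulr1 -[RHS]sigma_def.
have : D * (ofR a * sigma) = N.+1%:R * sigma * sigma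
  by rewrite mulrCA mulrA trace_eq.
rewrite norm_eq => e.
transitivity (D * (sigma ^+ 2 + N%:R * mu ^+ 2) - D * sigma ^+ 2).
  by ring.
by rewrite e; ring.
Qed.

End TightFrames.

(** * Block designs and the Gram matrix of the incidence matrix *)

(** Double count of the pairs of a block through [j] and another of its
vertices. *)
Lemma BIBD_replication (n b : nat) (K : 'I_b -> {set 'I_n}) (m lambda : nat) :
  is_BIBD K m lambda ->
  forall j, (#|[set i | j \in K i]| * m.-1 = lambda * n.-1)%N.
Proof.
move=> [_ _ cardK pairs] j.
transitivity (\sum_(i | j \in K i) \sum_(j' in predC1 j | j' \in K i) 1)%N.
  rewrite (eq_bigr (fun=> m.-1)) => [|i jKi]; first
    by rewrite sum_nat_const cardsE.
  rewrite sum1_card -(cardK i) (cardsD1 j) jKi; apply: eq_card => j'.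
  by rewrite !inE.
rewrite (exchange_big_dep (mem (predC1 j))) => [|i j' _ /andP[]//] /=.
rewrite (eq_bigr (fun=> lambda)) => [|j' j'j].
  by rewrite sum_nat_const cardC1 card_ord mulnC.
rewrite sum1_card -(pairs j j') 1?eq_sym //; apply: eq_card => i.
by move: j'j; rewrite !inE [LHS]unfold_in /= => ->.
Qed.

Section Incidence.
Variables (R : realType) (k : scalar_kind) (n b : nat).
Local Notation F := (scalars R k).

Lemma inner_col_Psi (K : 'I_b -> {set 'I_n}) (c : 'I_b -> 'I_n -> F)
    (lambda : nat) (j j' : 'I_n) :
  inner (@std_dot R k b) (col j (Psi K c lambda)) (col j' (Psi K c lambda)) =
  lambda%:R^-1 * \sum_(i | (j \in K i) && (j' \in K i)) conjS (c i j) * c i j'.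
Proof.
rewrite /inner /= /std_dot mulr_sumr [RHS]big_mkcond /=; apply: eq_bigr => i _.
rewrite !mxE; case: (j \in K i); last by rewrite /= raddf0 mulr0.
case: (j' \in K i); last by rewrite mul0r.
rewrite conjSM conjS_ofR mulrACA -rmorphM mulf_div mulr1 -expr2.
by rewrite sqr_sqrtr ?ler0n // mul1r fmorphV rmorph_nat [c i j' * _]mulrC.
Qed.

End Incidence.

(** * The Naimark complement *)

Theorem theorem5p1 (R : realType) (k : scalar_kind)
    (H : vectType (scalars R k)) (dot : {dot H for (@conjS R k)})
    (n d : nat) (phi : 'I_n -> H) (s : R)
    (b : nat) (K : 'I_b -> {set 'I_n}) (c : 'I_b -> 'I_n -> scalars R k) :
  (d < n)%N ->
  \dim {:H} = d ->
  s = Num.sqrt (d%:R * (n%:R - 1) / (n%:R - d%:R)) ->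
  ETF dot {:H}%VS phi ->
  (forall j, hnorm dot (phi j) ^+ 2 = s) ->
  (forall i,
     regular_simplex dot (fun j : {j : 'I_n | j \in K i} => phi (val j))) ->
  (forall i, \sum_(j in K i) conjS (c i j) *: phi j = 0) ->
  (forall i j, j \in K i -> `|c i j| = 1) ->
  (forall (i i' : 'I_b) (j j' : 'I_n), i != i' -> j != j' ->
     j \in K i :&: K i' -> j' \in K i :&: K i' ->
     conjS (c i j) * c i j' = conjS (c i' j) * c i' j')
  /\
  (forall m lambda : nat, m%:R = s + 1 -> is_BIBD K m lambda ->
     naimark_complement dot (@std_dot R k b) phi
       (fun j => col j (Psi K c lambda))).
Proof.
move=> d_lt_n dimH s_def [phi_neq0 _ [mu angles_mu] [a tight_phi]] norms.
move=> simplex relation c1.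
have n_gt0 : (0 < n)%N := leq_ltn_trans (leq0n d) d_lt_n.
have cardI : #|'I_n| = n.-1.+1 by rewrite card_ord prednK.
pose sigma : scalars R k := ofR s.
have norm_phi j : inner dot (phi j) (phi j) = sigma.
  by rewrite inner_self norms.
have sigma_neq0 : sigma != 0.
  by rewrite -(norm_phi (Ordinal n_gt0)) gt_eqF // neq0_dnorm_gt0.
have sigma_def : sigma ^+ 2 * (n.-1.+1%:R - (\dim {:H})%:R) =
    (\dim {:H})%:R * n.-1%:R.
  have n1_ge0 : 0 <= n%:R - 1 :> R by rewrite subr_ge0 ler1n.
  have nd_gt0 : 0 < n%:R - d%:R :> R by rewrite subr_gt0 ltr_nat.
  have : s ^+ 2 * (n%:R - d%:R) = d%:R * (n%:R - 1).
    rewrite s_def sqr_sqrtr ?divfK ?gt_eqF //.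
    by rewrite divr_ge0 ?mulr_ge0 ?ler0n // ltW.
  move/(congr1 (@ofR R k)).
  rewrite [LHS]rmorphM [RHS]rmorphM !rmorphB rmorphXn !rmorph_nat rmorph1.
  rewrite dimH prednK // => ->.
  by rewrite -subn1 natrB.
have angles j j' : j != j' -> `|inner dot (phi j) (phi j')| = 1.
  exact: (welch_coherence tight_phi cardI norm_phi sigma_neq0 angles_mu).
have gram_block i j j' : j \in K i -> j' \in K i -> j != j' ->
    conjS (c i j) * c i j' = - inner dot (phi j) (phi j').
  move=> jK j'K jj'.
  rewrite (@regular_simplex_gram _ _ _ _ _ _ sigma
    (fun l : {l | l \in K i} => c i (val l)) (simplex i) (fun l => norm_phi _)
    _ _ _ (Sub j jK) (Sub j' j'K)) ?opprK //.
  - move=> l l' ll'; apply: (angles (val l) (val l')).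
    by rewrite (inj_eq val_inj).
  - by have := relation i; rewrite big_sub.
  - by move=> l; apply: c1; apply: valP.
split=> [i i' j j' _ jj'|m lambda m_def bibd].
  by rewrite !inE => /andP[jK jK'] /andP[j'K j'K']; rewrite !gram_block.
exists a; split.
- case: tight_phi => a_gt0 _ tight.
  split=> // [j|y _]; last exact: tight (memvf y).
  by apply: memv_span; apply: map_f; rewrite mem_enum.
- by apply: leq_ltn_trans d_lt_n; rewrite -dimH dimvS ?subvf.
have [/andP[m_gt1 _] lambda_gt0 _ pairs] := bibd.
have lambda_neq0 : lambda%:R != 0 :> scalars R k by rewrite pnatr_eq0 -lt0n.
apply/matrixP => j j'; rewrite !mxE inner_col_Psi.
have [->|jj'] := eqVneq j j'; last first.
  rewrite mulr0n sub0r.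
  rewrite (eq_bigr (fun=> - inner dot (phi j) (phi j'))); last first.
    by move=> i /andP[jK j'K]; apply: gram_block.
  rewrite sumr_const -[#|_|](cardsE [pred i | (j \in K i) && (j' \in K i)]).
  by rewrite pairs // -[X in _ * X]mulr_natl mulKf.
rewrite mulr1n norm_phi.
have [_ norm_eq] := equiangular_tight_relations tight_phi cardI norm_phi angles.
rewrite (eq_bigr (fun=> 1)) => [|i /andP[jK _]]; last exact/conjS_mul_unit/c1.
rewrite (eq_bigl (fun i => j' \in K i)) => [|i]; last by rewrite andbb.
rewrite sumr_const -[#|_|](cardsE [pred i | j' \in K i]).
have sigmaE : sigma = m.-1%:R.
  apply: (addIr 1); rewrite natr1 prednK ?(ltnW m_gt1) //.
  by rewrite -[m%:R](rmorph_nat (@ofR R k)) m_def rmorphD rmorph1.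
have := congr1 (fun x => x%:R : scalars R k) (BIBD_replication bibd j').
rewrite /= !natrM -sigmaE => replication.
(* Cleared of its denominator [sigma], the goal is [norm_eq]. *)
apply: (mulIf sigma_neq0); rewrite -mulrA replication mulKf //.
by rewrite mulrBl norm_eq expr1n mulr1 -expr2 addrC addKr.
Qed.
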